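(* Let $m\ge 2$, $1\le\ell\le m$, and let $F=(f_1,\dots,f_\ell)$ be a bent vectorial function from $\mathrm{GF}(2^{2m})$ to $\mathrm{GF}(2)^\ell$. Then the binary code $\mathcal{C}(f_1,\dots,f_\ell)$ is spanned by its codewords of minimum weight (which is $2^{2m-1}-2^{m-1}$).
   Context: Write $\mathrm{GF}(2^{2m})=\{u_1,\dots,u_q\}$, $q=2^{2m}$, and let $\mathrm{tr}_{2m/1}$ be the absolute trace to $\mathrm{GF}(2)$. A Boolean function $f:\mathrm{GF}(2^{2m})\to\mathrm{GF}(2)$ is bent if $\left|\sum_{x}(-1)^{f(x)+\mathrm{tr}_{2m/1}(wx)}\right|=2^m$ for all $w$. $F=(f_1,\dots,f_\ell)$ is a bent vectorial function if $\sum_j a_jf_j$ is bent for every nonzero $(a_1,\dots,a_\ell)\in\mathrm{GF}(2)^\ell$. The truth table of $f$ is $(f(u_1),\dots,f(u_q))$. $\mathrm{RM}_2(1,2m)=\{(\mathrm{tr}_{2m/1}(bu_i)+c)_{i=1}^q:b\in\mathrm{GF}(2^{2m}),c\in\mathrm{GF}(2)\}$, and $\mathcal{C}(f_1,\dots,f_\ell)$ is the binary linear code spanned by $\mathrm{RM}_2(1,2m)$ and the truth tables of $f_1,\dots,f_\ell$. *)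

(* Defs.v *)
From HB Require Import structures.
From mathcomp Require Import all_boot all_order all_algebra all_field.

Set Implicit Arguments.
Unset Strict Implicit.
Unset Printing Implicit Defensive.

Import Order.TTheory GRing.Theory Num.Theory.
Local Open Scope ring_scope.

Section Trace.
Variables (K : finFieldType) (n : nat).

Definition abs_trace (x : K) : K := \sum_(i < n) x ^+ (2 ^ i).

(* The trace lies in the prime subfield {0, 1} of K (lemma tr2E), which is
   identified here with 'F_2. *)
Definition tr2 (x : K) : 'F_2 := (abs_trace x != 0)%:R.

Lemma tr2E (cardK : #|K| = (2 ^ n)%N) (x : K) :
  abs_trace x = (nat_of_ord (tr2 x))%:R.
Proof.
have ch2 : 2%N \in [pchar K] by apply: (card_finPcharP cardK).
have Frob : abs_trace x ^+ 2 = abs_trace x.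
  rewrite -(pFrobenius_autE ch2) /abs_trace rmorph_sum /=.
  under eq_bigr => i _ do rewrite pFrobenius_autE -exprM -expnSr.
  case: n cardK => [|k] cardK'; first by rewrite !big_ord0.
  rewrite big_ord_recr /= -cardK' expf_card [RHS]big_ord_recl addrC /=.
  by rewrite expn0 expr1.
move/eqP: Frob; rewrite expr2 -subr_eq0 -{3}[abs_trace x]mulr1 -mulrBr.
rewrite mulf_eq0 subr_eq0 /tr2 => /orP[] /eqP ->; first by rewrite eqxx.
by rewrite oner_eq0.
Qed.

End Trace.

Section Bent.
Variables (K : finFieldType) (m : nat).

Definition bent (f : K -> 'F_2) : Prop :=
  forall w : K,
    `|\sum_(x : K) (-1) ^+ nat_of_ord (f x + tr2 (2 * m)%N (w * x)) : int|
      = (2 ^ m)%:R.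

Definition bent_vectorial (l : nat) (F : K -> 'rV['F_2]_l) : Prop :=
  forall a : 'rV['F_2]_l, a != 0 ->
    bent (fun x => \sum_(j < l) a 0 j * F x 0 j).

End Bent.

Section Weight.
Variable n : nat.

Definition wt (v : 'rV['F_2]_n) : nat := #|[set i | v 0 i != 0]|.

(* For the zero code this is n by convention. *)
Definition min_weight (C : {vspace 'rV['F_2]_n}) : nat :=
  \big[minn/n]_(v : 'rV['F_2]_n | (v \in C) && (v != 0)) wt v.

Definition min_weight_codewords (C : {vspace 'rV['F_2]_n}) :
    {set 'rV['F_2]_n} :=
  [set v | [&& v \in C, v != 0 & wt v == min_weight C]].

End Weight.

Section Code.
Variables (K : finFieldType) (m : nat) (u : 'I_(2 ^ (2 * m)) -> K).

Definition truth_table (f : K -> 'F_2) : 'rV['F_2]_(2 ^ (2 * m)) :=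
  \row_i f (u i).

Definition RM1 : {set 'rV['F_2]_(2 ^ (2 * m))} :=
  [set truth_table (fun x => tr2 (2 * m)%N (b * x) + c) | b : K, c : 'F_2].

Definition code (l : nat) (F : K -> 'rV['F_2]_l) :
    {vspace 'rV['F_2]_(2 ^ (2 * m))} :=
  (<<enum RM1>> + <<[seq truth_table (fun x => F x 0%R j) | j : 'I_l]>>)%VS.

End Code.

(* Main.v *)
Require Import Defs.
From HB Require Import structures.
From mathcomp Require Import all_boot all_order all_algebra all_field.
From mathcomp Require Import zify.

Set Implicit Arguments.
Unset Strict Implicit.
Unset Printing Implicit Defensive.

Import Order.TTheory GRing.Theory Num.Theory.
Local Open Scope ring_scope.

(** Every codeword is [a . F + tr (b x) + c].  If [a = 0] its weight is [0],
    [q / 2] or [q]; otherwise it is a bent function and its weight is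
    [(q - W) / 2] with [W = 2^m] or [W = - 2^m], so that for all [a != 0] and
    [b] exactly one [c], the value [d b] of the dual of [g := a . F], gives a
    word [g + tr (b x) + d b] of minimum weight.  Sums of two such words are
    [tr ((b + b') x) + d b + d b'].  The dual cannot be affine: otherwise
    [\sum_w W_g w] would be [0], [2^m q] or [- 2^m q], whereas it equals [q] or
    [- q] since the trace form is nondegenerate.  Hence the all-one word lies in
    the span of the words of minimum weight, and with it all of RM(1, 2m) and
    all the [f_j]. *)

(** * Bits and their signs *)

Lemma F2P (x : 'F_2) : x = 0 \/ x = 1.
Proof. by case: x => [[|[|?]] ?] //; [left|right]; apply: val_inj. Qed.

Lemma addF2_self (x : 'F_2) : x + x = 0.
Proof. by case: (F2P x) => ->; apply: val_inj. Qed.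

Definition chi (x : 'F_2) : int := (-1) ^+ nat_of_ord x.

Lemma chiD x y : chi (x + y) = chi x * chi y.
Proof. by case: (F2P x) => ->; case: (F2P y) => ->. Qed.

Lemma normr_chi x : `|chi x| = 1.
Proof. by case: (F2P x) => ->. Qed.

(** * Character sums and nondegeneracy of the trace form *)

Section AdditiveFunctionals.
Variable K : finFieldType.

(** If [e y = 1], translation by [y] permutes [K] and flips every sign, so the sum equals its own
    opposite. *)
Lemma sum_chi_additive (e : K -> 'F_2) : {morph e : x y / x + y} ->
  (forall x, e x = 0) \/ \sum_x chi (e x) = 0.
Proof.
move=> eD; case: (pickP (fun y => e y != 0)) => [y ey|e0]; last first.
  by left=> x; apply/eqP; move: (e0 x) => /negbFE.
right; have {}ey : e y = 1 by case: (F2P (e y)) ey => ->; rewrite ?eqxx.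
have : \sum_x chi (e x) = - \sum_x chi (e x).
  rewrite [LHS](reindex_inj (addIr y)) /= -sumrN.
  by apply: eq_bigr => x _; rewrite eD ey chiD mulrN1.
lia.
Qed.

Section Trace.
Variable n : nat.
Hypothesis cardK : #|K| = (2 ^ n)%N.

Lemma pchar2 : 2%N \in [pchar K].
Proof. exact: (card_finPcharP cardK). Qed.

Lemma abs_traceD : {morph @abs_trace K n : x y / x + y}.
Proof.
move=> x y; rewrite /abs_trace -big_split; apply: eq_bigr => i _ /=.
rewrite (exprDn_pchar _ _ (n := 2 ^ i)) //.
by rewrite pnatX (pnatE _ (isT : prime 2)) pchar2.
Qed.

(** Additivity of [abs_trace] descends from [K] to ['F_2] because [1 + 1 = 0] and [1 != 0] in
    [K]. *)
Lemma tr2D : {morph @tr2 K n : x y / x + y}.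
Proof.
move=> x y; have := tr2E cardK (x + y).
rewrite abs_traceD !(tr2E cardK).
have : (1 + 1 : K) = 0 by have := pcharf0 pchar2.
case: (F2P (tr2 n x)) => ->; case: (F2P (tr2 n y)) => ->;
  case: (F2P (tr2 n (x + y))) => -> /=; rewrite ?addr0 ?add0r => h1 => /eqP;
  rewrite ?oner_eq0 1?eq_sym ?oner_eq0 // ?h1 ?oner_eq0 // => _; exact: val_inj.
Qed.

(** Otherwise a nonzero polynomial of degree at most [2 ^ n.-1] would vanish at all [2 ^ n] elements
    of [K]. *)
Lemma tr2_nontrivial : (0 < n)%N -> exists z : K, tr2 n z = 1.
Proof.
move=> n_gt0; case: (pickP (fun z : K => abs_trace n z != 0)) => [z hz|tr0].
  by exists z; rewrite /tr2 hz.
pose p : {poly K} := \sum_(i < n) 'X^(2 ^ i).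
have sz : (size p <= (2 ^ n.-1).+1)%N.
  apply: leq_trans (size_sum _ _ _) _; apply/bigmax_leqP => i _.
  by rewrite size_polyXn ltnS leq_exp2l //; have := ltn_ord i; lia.
have p_neq0 : p != 0.
  (* Only the summand [i = 0] contributes to the coefficient of ['X]. *)
  apply/eqP => /(congr1 (fun r : {poly K} => r`_1)).
  rewrite coef0 coef_sum (bigD1 (Ordinal n_gt0)) //= coefXn expn0 eqxx.
  rewrite big1 => [|i ine]; first by rewrite addr0; apply/eqP; rewrite oner_eq0.
  rewrite coefXn; case: eqP => // /eqP; rewrite eq_sym -(expn0 2) eqn_exp2l //.
  by move=> /eqP i0; case/eqP: ine; apply: val_inj.
have roots_p : all (root p) (enum K).
  apply/allP => z _; rewrite /root /p horner_sum.
  under eq_bigr do rewrite hornerXn.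
  by move: (tr0 z) => /negbFE.
have := max_poly_roots p_neq0 roots_p (enum_uniq _).
rewrite -cardE cardK => /leq_trans/(_ sz).
by rewrite ltnS leq_exp2l //; lia.
Qed.

Lemma sum_chi_tr2 (x : K) : (0 < n)%N ->
  \sum_w chi (tr2 n (w * x)) = if x == 0 then (2 ^ n)%:R else 0.
Proof.
move=> n_gt0; have tr20 : tr2 n (0 : K) = 0.
  by have := tr2D 0 0; rewrite addr0 addF2_self.
case: eqP => [->|/eqP x_neq0].
  under eq_bigr do rewrite mulr0 tr20.
  by rewrite sumr_const cardK.
have [w w' |tr0|//] := @sum_chi_additive (fun w => tr2 n (w * x)).
  by rewrite mulrDl tr2D.
have [z hz] := tr2_nontrivial n_gt0.
by have := tr0 (z / x); rewrite mulfVK // hz.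
Qed.

End Trace.
End AdditiveFunctionals.

(** * Bent functions and their duals *)

Section Bent.
Variables (K : finFieldType) (m : nat).
Hypotheses (m_gt0 : (0 < m)%N) (cardK : #|K| = (2 ^ (2 * m))%N).
Local Notation tr := (tr2 (2 * m)%N).

(** The bit [d] records the sign of the Walsh coefficient at [w]; as a function of [w] it is the
    dual of [f]. *)
Lemma bent_walsh (f : K -> 'F_2) (w : K) : bent m f ->
  exists d : 'F_2, \sum_x chi (f x + tr (w * x)) = chi d * (2 ^ m)%:R.
Proof.
move=> /(_ w); rewrite /chi; set S := \sum_x _ => hS.
case: (leP 0 S) => [S_ge0|S_lt0]; [exists 0|exists 1]; rewrite /= ?expr0 ?expr1.
  by rewrite -hS mul1r ger0_norm.
by rewrite -hS mulN1r ltr0_norm // opprK.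
Qed.

Lemma bent_dual_not_affine (f d : K -> 'F_2) :
  (forall w, \sum_x chi (f x + tr (w * x)) = chi (d w) * (2 ^ m)%:R) ->
  exists w w', d (w + w') + d w + d w' + d 0 = 1.
Proof.
move=> walsh.
case: (pickP (fun w => [exists w', d (w + w') + d w + d w' + d 0 == 1])).
  by move=> w /existsP[w' /eqP h]; exists w, w'.
(* If all these second differences vanish, [d] is affine, so subtracting [d 0] makes it additive. *)
move=> affine; have eD : {morph (fun w => d w + d 0) : w w' / w + w'}.
  move=> w w'; have /negbT/existsPn/(_ w') := affine w.
  by case: (F2P (d (w + w'))) => ->; case: (F2P (d w)) => ->;
     case: (F2P (d w')) => ->; case: (F2P (d 0)) => ->; move=> // _;
     apply: val_inj.
(* After exchanging the sums, orthogonality keeps only [x = 0]. *)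
have sumW : \sum_w \sum_x chi (f x + tr (w * x)) = chi (f 0) * (2 ^ (2 * m))%:R.
  rewrite exchange_big /= (bigD1 0) //= [X in _ + X]big1 ?addr0 => [|x /negbTE x0].
    under eq_bigr do rewrite chiD.
    by rewrite -mulr_sumr (sum_chi_tr2 cardK) ?eqxx //; lia.
  under eq_bigr do rewrite chiD.
  by rewrite -mulr_sumr (sum_chi_tr2 cardK) ?x0 ?mulr0 //; lia.
have {}sumW : \sum_w chi (d w + d 0)
    * (chi (d 0) * (2 ^ m)%:R) = chi (f 0) * (2 ^ (2 * m))%:R.
  rewrite -sumW; apply: eq_bigr => w _.
  by rewrite walsh mulrA -chiD -addrA addF2_self addr0.
(* With [q = 2 ^ (2 * m)], the absolute values would give [0 = q] or [q * 2 ^ m = q]. *)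
have /(congr1 Num.norm) := sumW; rewrite -mulr_suml !normrM !normr_chi !mul1r.
have q_gt0 : (0 < 2 ^ (2 * m))%N by rewrite expn_gt0.
have [e0|->] := sum_chi_additive eD; last first.
  by rewrite normr0 mul0r normr_nat; lia.
under eq_bigr do rewrite e0.
rewrite sumr_const cardK !normr_nat -natrM => /eqP; rewrite eqr_nat.
have : (1 < 2 ^ m)%N by rewrite -(expn0 2) ltn_exp2l.
nia.
Qed.

End Bent.

Lemma min_weight_eq n (C : {vspace 'rV['F_2]_n}) (k : nat) (v : 'rV['F_2]_n) :
  v \in C -> v != 0 -> wt v = k ->
  (forall w, w \in C -> w != 0 -> (k <= wt w)%N) -> min_weight C = k.
Proof.
move=> vC v0 wtv lb; apply/eqP; rewrite eqn_leq; apply/andP; split.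
  rewrite -wtv /min_weight -minEnat.
  by apply: (@bigmin_le_cond _ _ _ n v _ (@wt n)); rewrite vC v0.
rewrite /min_weight; apply: (big_ind (leq k)) => [|x y kx ky|w /andP[]]; last exact: lb.
  (* The default value [n] of the minimum is at least [k], since [k] is the weight of [v]. *)
  by rewrite -wtv (leq_trans (max_card _)) // card_ord.
by rewrite leq_min kx.
Qed.

(** * Parametrization of the code and weights of its words *)

Section Code.
Variables (K : finFieldType) (m l : nat).
Variables (u : 'I_(2 ^ (2 * m)) -> K) (F : K -> 'rV['F_2]_l).
Hypotheses (m_gt0 : (0 < m)%N) (l_gt0 : (0 < l)%N).
Hypotheses (cardK : #|K| = (2 ^ (2 * m))%N) (u_bij : bijective u).
Hypothesis F_bent : bent_vectorial m F.
Local Notation tr := (tr2 (2 * m)%N).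

Definition component (a : 'rV['F_2]_l) (x : K) : 'F_2 :=
  \sum_(j < l) a 0 j * F x 0 j.

Definition codeword (a : 'rV['F_2]_l) (b : K) (c : 'F_2) :
    'rV['F_2]_(2 ^ (2 * m)) :=
  truth_table u (fun x => component a x + (tr (b * x) + c)).

Lemma truth_tableD f g :
  truth_table u f + truth_table u g = truth_table u (fun x => f x + g x).
Proof. by apply/rowP => i; rewrite !mxE. Qed.

Lemma eq_truth_table f g : f =1 g -> truth_table u f = truth_table u g.
Proof. by move=> fg; apply/rowP => i; rewrite !mxE fg. Qed.

Lemma componentD a a' x :
  component (a + a') x = component a x + component a' x.
Proof.
by rewrite /component -big_split; apply: eq_bigr => j _; rewrite !mxE mulrDl.
Qed.

Lemma component0 x : component 0 x = 0.
Proof. by rewrite /component big1 // => j _; rewrite mxE mul0r. Qed.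

Lemma component_delta j x : component (delta_mx 0 j) x = F x 0 j.
Proof.
rewrite /component (bigD1 j) //= mxE !eqxx mul1r big1 ?addr0 // => i /negbTE ij.
by rewrite mxE ij andbF mul0r.
Qed.

Lemma codewordD a b c a' b' c' :
  codeword a b c + codeword a' b' c' = codeword (a + a') (b + b') (c + c').
Proof.
rewrite truth_tableD; apply: eq_truth_table => x.
by rewrite componentD mulrDl (tr2D cardK) addrACA; congr (_ + _); rewrite addrACA.
Qed.

Lemma codeword000 : codeword 0 0 0 = 0.
Proof.
apply/rowP => i; rewrite !mxE component0 add0r addr0 mul0r.
by have := tr2D cardK 0 0; rewrite addr0 addF2_self.
Qed.

Lemma RM1_codeword b c :
  truth_table u (fun x => tr (b * x) + c) = codeword 0 b c.
Proof. by apply: eq_truth_table => x; rewrite component0 add0r. Qed.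

Lemma truth_table_codeword j :
  truth_table u (fun x => F x 0 j) = codeword (delta_mx 0 j) 0 0.
Proof.
apply: eq_truth_table => x; rewrite component_delta mul0r addr0.
by have := tr2D cardK 0 0; rewrite addr0 addF2_self => ->; rewrite addr0.
Qed.

Lemma code_subvP (U : {vspace 'rV['F_2]_(2 ^ (2 * m))}) :
  (forall b c, codeword 0 b c \in U) ->
  (forall j, codeword (delta_mx 0 j) 0 0 \in U) -> (code u F <= U)%VS.
Proof.
move=> RU FU; rewrite /code subv_add; apply/andP; split; apply/span_subvP => v.
  by rewrite mem_enum => /imset2P[b c _ _ ->]; rewrite RM1_codeword.
by move=> /mapP[j _ ->]; rewrite truth_table_codeword.
Qed.

Lemma codeword_in_code a b c : codeword a b c \in code u F.
Proof.
have -> : codeword a b c =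
    codeword 0 b c + \sum_j a 0 j *: truth_table u (fun x => F x 0 j).
  apply/rowP => i; rewrite !mxE component0 add0r addrC; congr (_ + _).
  by rewrite summxE; apply: eq_bigr => j _; rewrite !mxE.
apply: memv_add.
  by apply: memv_span; rewrite mem_enum -RM1_codeword; apply: imset2_f.
by apply: memv_suml => j _; apply/memvZ/memv_span/map_f; rewrite mem_enum.
Qed.

(** Words of this form include the generators and [0] and are closed under addition, which suffices
    since the only scalars are [0] and [1]. *)
Lemma in_codeP v : v \in code u F -> exists a b c, v = codeword a b c.
Proof.
pose is_cw v := exists a b c, v = codeword a b c.
have span_cw X : {in X, forall v, is_cw v} ->
    forall v, v \in <<X>>%VS -> is_cw v.
  move=> hX w /(@coord_span _ _ _ (in_tuple X)) ->; apply: (big_ind is_cw).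
  - by exists 0, 0, 0; rewrite codeword000.
  - move=> _ _ [a [b [c ->]]] [a' [b' [c' ->]]].
    by rewrite codewordD; do 3!eexists.
  move=> i _; case: (F2P (coord (in_tuple X) i w)) => ->.
    by rewrite scale0r; exists 0, 0, 0; rewrite codeword000.
  by rewrite scale1r; apply: hX; apply: mem_nth; apply: ltn_ord.
case/memv_addP => v1 v1R [v2 v2F ->].
have [w|a [b [c ->]]] := span_cw _ _ _ v1R.
  rewrite mem_enum => /imset2P[b c _ _ ->]; rewrite RM1_codeword.
  by do 3!eexists.
have [w|a' [b' [c' ->]]] := span_cw _ _ _ v2F.
  by move=> /mapP[j _ ->]; rewrite truth_table_codeword; do 3!eexists.
by rewrite codewordD; do 3!eexists.
Qed.

(** Each sign is [1 - 2 [f x != 0]]. Doubling the weight, in [int], avoids division and truncated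
    subtraction. *)
Lemma wt_truth_table f :
  (wt (truth_table u f))%:R *+ 2 = (2 ^ (2 * m))%:R - \sum_x chi (f x) :> int.
Proof.
have -> : \sum_x chi (f x) = \sum_(x : K) (1 - (f x != 0)%:R *+ 2).
  by apply: eq_bigr => x _; case: (F2P (f x)) => ->.
rewrite sumrB sumr_const cardK subKr sumrMnl; congr (_ *+ 2).
rewrite (reindex u) /=; last exact: onW_bij.
rewrite -natr_sum /wt -sum1dep_card big_mkcond /=; congr (_%:R).
by apply: eq_bigr => i _; rewrite mxE; case: (f _ != 0).
Qed.

Local Notation minwt := (2 ^ (2 * m - 1) - 2 ^ (m - 1))%N.

Lemma minwt_double :
  (minwt.*2 + 2 ^ m = 2 ^ (2 * m))%N /\ (2 ^ m < 2 ^ (2 * m))%N.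
Proof.
have h1 : (2 ^ (2 * m) = 2 * 2 ^ (2 * m - 1))%N.
  by rewrite -expnS; congr expn; lia.
have h2 : (2 ^ m = 2 * 2 ^ (m - 1))%N by rewrite -expnS; congr expn; lia.
have h3 : (2 ^ m < 2 ^ (2 * m))%N by rewrite ltn_exp2l //; lia.
by split=> //; lia.
Qed.

Lemma wt_codeword_ge a b c :
  codeword a b c != 0 -> (minwt <= wt (codeword a b c))%N.
Proof.
have [dbl lt_mq] := minwt_double.
have := wt_truth_table (fun x => component a x + (tr (b * x) + c)).
rewrite -/(codeword a b c); under eq_bigr do rewrite addrA chiD.
rewrite -mulr_suml; set w := wt _ => hw.
(* For [a != 0] the character sum is at most [2 ^ m] in absolute value. *)
have [a0|a_neq0] := eqVneq a 0; last first.
  have [d hd] := bent_walsh b (F_bent a_neq0).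
  move: hw; rewrite hd; have := normr_chi d; have := normr_chi c.
  by case: (F2P c) => ->; case: (F2P d) => -> /=;
     rewrite /chi /= ?expr0 ?expr1; lia.
move=> nz; have trD : {morph (fun x => tr (b * x)) : x y / x + y}.
  by move=> x y; rewrite mulrDr (tr2D cardK).
(* A nonzero linear functional is balanced, giving weight [q / 2]; otherwise the word is constant
   and nonzero, hence all-one. *)
have [tr0|sum0] := sum_chi_additive trD; last first.
  have : \sum_x chi (component a x + tr (b * x)) = 0.
    by rewrite -[RHS]sum0; apply: eq_bigr => x _; rewrite a0 component0 add0r.
  by move=> h; move: hw; rewrite h mul0r; lia.
have c1 : c = 1.
  case: (F2P c) => // c0; case/eqP: nz.
  by apply/rowP => i; rewrite !mxE a0 component0 tr0 c0 !addr0.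
have : \sum_x chi (component a x + tr (b * x)) = (2 ^ (2 * m))%:R.
  rewrite -cardK -sumr_const; apply: eq_bigr => x _.
  by rewrite a0 component0 tr0 addr0.
by move=> h; move: hw; rewrite h c1 /chi /= expr1; lia.
Qed.

(** Adding the constant [d] multiplies the sum by [chi d], which makes it [+ 2 ^ m] and so gives the
    smaller of the two possible weights. *)
Lemma wt_codeword_dual a b d :
  \sum_x chi (component a x + tr (b * x)) = chi d * (2 ^ m)%:R ->
  wt (codeword a b d) = minwt.
Proof.
move=> hd; have [dbl lt_mq] := minwt_double.
have := wt_truth_table (fun x => component a x + (tr (b * x) + d)).
rewrite -/(codeword a b d); under eq_bigr do rewrite addrA chiD.
rewrite -mulr_suml hd; set w := wt _.
by case: (F2P d) => ->; rewrite /chi /= ?expr0 ?expr1; lia.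
Qed.

Lemma codeword_dual_neq0 a b d :
  wt (codeword a b d) = minwt -> codeword a b d != 0.
Proof.
have [dbl lt_mq] := minwt_double; move=> hw; apply/eqP => h0; move: hw.
rewrite h0 /wt; set A := [set _ | _].
have -> : A = set0 by apply/setP => i; rewrite !inE mxE eqxx.
by rewrite cards0; lia.
Qed.

Lemma delta_neq0 j : (delta_mx 0 j : 'rV['F_2]_l) != 0.
Proof. by apply/eqP => /rowP/(_ j)/eqP; rewrite !mxE !eqxx. Qed.

Lemma min_weight_code : min_weight (code u F) = minwt.
Proof.
pose j := Ordinal l_gt0; have [d hd] := bent_walsh 0 (F_bent (delta_neq0 j)).
have hw := wt_codeword_dual hd.
apply: (min_weight_eq (codeword_in_code _ _ _) (codeword_dual_neq0 hw) hw).
by move=> w /in_codeP[a [b [c ->]]]; apply: wt_codeword_ge.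
Qed.

(** * The span of the words of minimum weight *)

Local Notation minspan := <<enum (min_weight_codewords (code u F))>>%VS.

Lemma minspan_dual (a : 'rV['F_2]_l) : a != 0 -> exists2 d : K -> 'F_2,
  (forall w, \sum_x chi (component a x + tr (w * x)) = chi (d w) * (2 ^ m)%:R)
  & forall w, codeword a w (d w) \in minspan.
Proof.
move=> a_neq0.
have /fin_all_exists[d hd] := fun w => bent_walsh w (F_bent a_neq0).
exists d => // w; have hw := wt_codeword_dual (hd w).
apply: memv_span; rewrite mem_enum inE codeword_in_code codeword_dual_neq0 //=.
by rewrite min_weight_code hw.
Qed.

Lemma addrr_rVF2 (a : 'rV['F_2]_l) : a + a = 0.
Proof. by apply/rowP => i; rewrite !mxE addF2_self. Qed.

Lemma addrr_K (x : K) : x + x = 0.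
Proof. by rewrite (addrr_pchar2 (pchar2 cardK)). Qed.

Lemma minspan_RM1 b c : codeword 0 b c \in minspan.
Proof.
have [d hd hS] := minspan_dual (delta_neq0 (Ordinal l_gt0)).
have S1 : codeword 0 0 1 \in minspan.
  (* In the sum of the four words at [w + w'], [w], [w'] and [0], the bent and trace parts cancel,
     leaving the constant [1]. *)
  have [w [w' dww']] := bent_dual_not_affine m_gt0 cardK hd.
  have := memvD (memvD (memvD (hS (w + w')) (hS w)) (hS w')) (hS 0).
  by rewrite !codewordD dww' addr0 -(addrA (w + w')) addrr_K addrr_rVF2 add0r addrr_rVF2.
(* Two words with the same bent part differ by an affine function; the all-one word then adjusts its
   constant. *)
have Sd : codeword 0 b (d b + d 0) \in minspan.
  by have := memvD (hS b) (hS 0); rewrite codewordD addrr_rVF2 addr0.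
have [->//|hc] : c = d b + d 0 \/ c = d b + d 0 + 1.
  by case: (F2P c) => ->; case: (F2P (d b + d 0)) => ->;
     (by left) || (right; apply: val_inj).
by rewrite hc; have := memvD Sd S1; rewrite codewordD !addr0.
Qed.

Lemma minspan_code : minspan = code u F.
Proof.
apply/eqP; rewrite eqEsubv; apply/andP; split.
  by apply/span_subvP => v; rewrite mem_enum inE => /andP[].
apply: code_subvP => [|j]; first exact: minspan_RM1.
have [d _ hS] := minspan_dual (delta_neq0 j).
(* The word of minimum weight at [0] is the truth table of the [j]-th coordinate plus the constant
   [d 0]. *)
have := memvD (hS 0) (minspan_RM1 0 (d 0)).
by rewrite codewordD !addr0 addF2_self.
Qed.

End Code.

Theorem theorem13 (m l : nat) (K : finFieldType)
    (u : 'I_(2 ^ (2 * m)) -> K) (F : K -> 'rV['F_2]_l)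
    (m_ge2 : (2 <= m)%N) (l_bounds : (1 <= l <= m)%N)
    (cardK : #|K| = (2 ^ (2 * m))%N) (u_bij : bijective u)
    (F_bent : bent_vectorial m F) :
  min_weight (code u F) = (2 ^ (2 * m - 1) - 2 ^ (m - 1))%N
  /\ <<enum (min_weight_codewords (code u F))>>%VS = code u F.
Proof.
have m_gt0 : (0 < m)%N by lia.
have l_gt0 : (0 < l)%N by case/andP: l_bounds.
by split; [apply: min_weight_code | apply: minspan_code].
Qed.
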